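(* Suppose that for each product $j\in\mathscr P$ all customers observe the same historical price, $P_{ij}=P_j$ for all $i\in\mathscr C$. Then the price vector $\mathbf p^*$ with $p^*_j=P_j$ for all $j\in\mathscr P$ is optimal to (OP-MIP).
   Context: There are customers $\mathscr C=\{1,\dots,m\}$ and products $\mathscr P=\{1,\dots,n\}$. Customer $i$ saw historical prices $P_{ij}>0$ and purchased product $c_i\in\mathscr P$. Let $P^{\max}=\max_iP_{ic_i}$. (OP-MIP): maximize $\sum_{i}\bar\tau_i$ over $\mathbf p\in\mathbb R^n_+$, $\boldsymbol\tau,\bar{\boldsymbol\tau}\in\mathbb R^m_+$, $\mathbf y\in\{0,1\}^{m\times n}$ subject to, for all $i\in\mathscr C$: $\tau_i\le p_j+(1-y_{ij})P_{ic_i}$ for all $j\in\mathscr P$; $p_{c_i}\le P_{ic_i}+(P^{\max}-P_{ic_i})(1-y_{ic_i})$; $p_j-p_{c_i}\ge P_{ij}-P_{ic_i}-(P^{\max}+P_{ij}-P_{ic_i})y_{ij}$ for all $j\ne c_i$; $\bar\tau_i\le y_{ic_i}P_{ic_i}$; $\bar\tau_i\le\tau_i$; $\bar\tau_i\ge\tau_i-(1-y_{ic_i})P_{ic_i}$. A price vector is optimal to (OP-MIP) if it is the $\mathbf p$-component of an optimal solution. *)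

(* Defs.v *)
From mathcomp Require Import all_boot all_order all_algebra.
From mathcomp Require Import reals.

Set Implicit Arguments.
Unset Strict Implicit.
Unset Printing Implicit Defensive.

Import Order.TTheory GRing.Theory Num.Theory.
Local Open Scope ring_scope.

(* Customers are 'I_m and products 'I_n (indices shifted to start at 0);
   [P i j] is the historical price of product j seen by customer i, and
   [c i] is the product purchased by customer i. *)

(* The default 0 is never selected when there is a customer, because
   historical prices are positive. *)
Definition max_purchase_price (R : realType) (m n : nat)
    (P : 'M[R]_(m, n)) (c : 'I_m -> 'I_n) : R :=
  \big[Num.max/0]_(i < m) P i (c i).

Record op_mip_point (R : realType) (m n : nat) := OpMipPoint {
  op_p : 'rV[R]_n;
  op_tau : 'rV[R]_m;
  op_taubar : 'rV[R]_m;
  op_y : 'M[bool]_(m, n)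
}.

(* [(y i j)%:R] is the 0/1 value of the binary variable in [R]. *)
Record op_mip_feasible (R : realType) (m n : nat)
    (P : 'M[R]_(m, n)) (c : 'I_m -> 'I_n) (s : op_mip_point R m n) : Prop :=
  OpMipFeasible {
  op_p_ge0 : forall j, 0 <= op_p s 0 j;
  op_tau_ge0 : forall i, 0 <= op_tau s 0 i;
  op_taubar_ge0 : forall i, 0 <= op_taubar s 0 i;
  op_tau_le_price : forall i j,
    op_tau s 0 i <= op_p s 0 j + (1 - (op_y s i j)%:R) * P i (c i);
  op_purchased_price : forall i,
    op_p s 0 (c i) <= P i (c i)
      + (max_purchase_price P c - P i (c i)) * (1 - (op_y s i (c i))%:R);
  op_price_difference : forall i j, j != c i ->
    op_p s 0 j - op_p s 0 (c i) >= P i j - P i (c i)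
      - (max_purchase_price P c + P i j - P i (c i)) * (op_y s i j)%:R;
  op_taubar_le_purchase : forall i,
    op_taubar s 0 i <= (op_y s i (c i))%:R * P i (c i);
  op_taubar_le_tau : forall i, op_taubar s 0 i <= op_tau s 0 i;
  op_taubar_ge_tau : forall i,
    op_taubar s 0 i >= op_tau s 0 i - (1 - (op_y s i (c i))%:R) * P i (c i)
}.

Definition op_mip_objective (R : realType) (m n : nat)
    (s : op_mip_point R m n) : R :=
  \sum_(i < m) op_taubar s 0 i.

Definition op_mip_optimal (R : realType) (m n : nat)
    (P : 'M[R]_(m, n)) (c : 'I_m -> 'I_n) (s : op_mip_point R m n) : Prop :=
  op_mip_feasible P c s /\
  forall s' : op_mip_point R m n, op_mip_feasible P c s' ->
    op_mip_objective s' <= op_mip_objective s.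

Definition op_mip_optimal_price (R : realType) (m n : nat)
    (P : 'M[R]_(m, n)) (c : 'I_m -> 'I_n) (p : 'rV[R]_n) : Prop :=
  exists s : op_mip_point R m n, op_mip_optimal P c s /\ op_p s = p.

(* Main.v *)
Require Import Defs.
From mathcomp Require Import all_boot all_order all_algebra.
From mathcomp Require Import reals.

Set Implicit Arguments.
Unset Strict Implicit.
Unset Printing Implicit Defensive.

Import Order.TTheory GRing.Theory Num.Theory.
Local Open Scope ring_scope.

(** No pricing can extract from customer [i] more than the price [P i (c i)]
    that this customer once paid: this bounds every feasible objective value by
    the sum of all purchase prices ([op_mip_objective_le]).  When all customers
    saw the same prices, charging exactly those prices attains this bound.
    Every price difference is then the historical one, so each customer can be
    declared to keep only the purchased product, which is still affordable, and
    pays for it in full ([historical_point_feasible]). *)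

Lemma op_mip_objective_le (R : realType) (m n : nat) (P : 'M[R]_(m, n))
    (c : 'I_m -> 'I_n) (P_ge0 : forall i j, 0 <= P i j)
    (s : op_mip_point R m n) :
  op_mip_feasible P c s -> op_mip_objective s <= \sum_(i < m) P i (c i).
Proof.
move=> s_feasible; apply: ler_sum => i _.
apply: le_trans (op_taubar_le_purchase s_feasible i) _.
by rewrite ler_piMl // lern1 leq_b1.
Qed.

(** The binary [y i j] is 1 only at the purchased product.  This choice leaves
    [p j + P i (c i)] as the bound on the payment at any other product [j], so a
    cheaper [j] does not push the payment below [P i (c i)]. *)
Definition historical_point (R : realType) (m n : nat) (P : 'M[R]_(m, n))
    (c : 'I_m -> 'I_n) (p : 'rV[R]_n) : op_mip_point R m n :=
  OpMipPoint p (\row_i P i (c i)) (\row_i P i (c i))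
    (\matrix_(i, j) (j == c i)).

(** Each constraint at the purchased product holds with equality, and each
    price difference equals the historical one, so the constraints with
    [y i j = 0] impose nothing beyond nonnegativity of the prices. *)
Lemma historical_point_feasible (R : realType) (m n : nat)
    (P : 'M[R]_(m, n)) (c : 'I_m -> 'I_n) (P_ge0 : forall i j, 0 <= P i j)
    (p : 'rV[R]_n) (p_ge0 : forall j, 0 <= p 0 j)
    (P_same : forall i j, P i j = p 0 j) :
  op_mip_feasible P c (historical_point P c p).
Proof.
split=> /= [//|i|i|i j|i|i j j_neq_c|i|i|i]; rewrite !mxE ?eqxx //.
- have [->|_] := eqVneq j (c i); first by rewrite subrr mul0r addr0 P_same.
  by rewrite subr0 mul1r lerDr.
- by rewrite subrr mulr0 addr0 P_same.
- by rewrite (negPf j_neq_c) mulr0 subr0 !P_same.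
- by rewrite mul1r.
- by rewrite subrr mul0r subr0.
Qed.

Theorem proposition8 (R : realType) (m n : nat) (m_gt0 : (0 < m)%N)
    (P : 'M[R]_(m, n)) (c : 'I_m -> 'I_n)
    (P_gt0 : forall i j, 0 < P i j)
    (Pbar : 'rV[R]_n)
    (P_same : forall i j, P i j = Pbar 0 j) :
  op_mip_optimal_price P c Pbar.
Proof.
have P_ge0 i j : 0 <= P i j by exact: ltW.
(* The common price of a product is nonnegative because some customer saw it. *)
have Pbar_ge0 j : 0 <= Pbar 0 j by rewrite -(P_same (Ordinal m_gt0)).
exists (historical_point P c Pbar); split=> //; split.
  exact: historical_point_feasible.
move=> s /(op_mip_objective_le P_ge0) /le_trans; apply.
by rewrite /op_mip_objective; apply: ler_sum => i _; rewrite mxE.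
Qed.
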